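(* Let $G$ be the free semigroup generated by continuous maps $f_1,\dots,f_m$ acting on a compact metric space $(X,d)$, and let $\mu$ be a $G$-ergodic Borel probability measure on $X$ with full support. Then there exists a countable subset $Q\subset\mathbb{R}$ such that for every $\varepsilon>0$ with $\varepsilon\notin Q$, every $\omega\in\Sigma_m^+$ and every integer $k\ge 1$, $$\lim_{n\to+\infty} C(G,x,\varepsilon,\omega,k,n)=\int_X \mu\big(B^G_{\omega,k}(y,\varepsilon)\big)\,d\mu(y)\qquad\text{for } \mu\text{-a.e. } x\in X.$$ Furthermore, for $\mu$-a.e. $x\in X$, $$\overline{h}_{cor}(G,\mu,2)=\overline{h}_{cor}(G,x),\qquad \underline{h}_{cor}(G,\mu,2)=\underline{h}_{cor}(G,x).$$
   Context: Setting. $(X,d)$ is a compact metric space, $f_1,\dots,f_m:X\to X$ are continuous, $G$ is the free semigroup generated by $\{f_1,\dots,f_m\}$ acting on $X$. Fix a probability vector $p=(p_1,\dots,p_m)$ with all $p_i>0$ and $\sum_i p_i=1$; let $\Sigma_m^+=\{1,\dots,m\}^{\mathbb{N}}$, let $\mathbb{P}$ be the Bernoulli (product) measure on $\Sigma_m^+$ generated by $p$, and let $\sigma$ be the left shift on $\Sigma_m^+$. For $\omega=(i_1,i_2,\dots)\in\Sigma_m^+$ put $f_{\omega,0}=\mathrm{id}$ and $f_{\omega,n}=f_{i_n}\circ\cdots\circ f_{i_1}$ for $n\ge1$. For $k\ge 1$ put $$d^G_{\omega,k}(x,y)=\max_{0\le i\le k-1} d(f_{\omega,i}(x),f_{\omega,i}(y)),\qquad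 B^G_{\omega,k}(x,\varepsilon)=\{y\in X: d^G_{\omega,k}(x,y)\le\varepsilon\}.$$ The skew product is $F:\Sigma_m^+\times X\to\Sigma_m^+\times X$, $F(\omega,x)=(\sigma(\omega),f_{\omega,1}(x))$. A Borel probability measure $\mu$ on $X$ is $G$-ergodic if $\mathbb{P}\times\mu$ is invariant and ergodic with respect to $F$. Correlation sum. For $x\in X$, $\varepsilon>0$, $\omega\in\Sigma_m^+$, $k,n\ge1$, $$C(G,x,\varepsilon,\omega,k,n)=\frac1{n^2}\int_{\Sigma_m^+}\sharp\{(i,j):0\le i,j\le n-1,\ d^G_{\omega,k}(f_{\upsilon,i}(x),f_{\upsilon,j}(x))\le\varepsilon\}\,d\mathbb{P}(\upsilon),$$ $\underline{C}(G,x,\varepsilon,\omega,k)=\liminf_{n\to+\infty}C(G,x,\varepsilon,\omega,k,n)$ and $\overline{C}(G,x,\varepsilon,\omega,k)=\limsup_{n\to+\infty}C(G,x,\varepsilon,\omega,k,n)$. Local correlation entropy. $$\overline{h}_{cor}(G,x)=\lim_{\varepsilon\to0}\limsup_{k\to+\infty}-\frac1k\int_{\Sigma_m^+}\log\underline{C}(G,x,\varepsilon,\omega,k)\,d\mathbb{P}(\omega),$$ $$\underline{h}_{cor}(G,x)=\lim_{\varepsilon\to0}\liminf_{k\to+\infty}-\frac1k\int_{\Sigma_m^+}\log\overline{C}(G,x,\varepsilon,\omega,k)\,d\mathbb{P}(\omega).$$ Correlation entropy of order 2. $$\overline{h}_{cor}(G,\mu,2)=\lim_{\varepsilon\to0}\limsup_{k\to+\infty}-\frac1k\int_{\Sigma_m^+}\log\Big(\int_X\mu(B^G_{\omega,k}(x,\varepsilon))\,d\mu(x)\Big)d\mathbb{P}(\omega),$$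 and $\underline{h}_{cor}(G,\mu,2)$ is defined with $\liminf_{k\to+\infty}$ in place of $\limsup_{k\to+\infty}$. *)

(* Defs.v *)
From HB Require Import structures.
From mathcomp Require Import all_boot all_order all_algebra.
From mathcomp Require Import all_classical all_reals all_analysis.

Set Implicit Arguments.
Unset Strict Implicit.
Unset Printing Implicit Defensive.

Import Order.TTheory GRing.Theory Num.Theory.
Import numFieldNormedType.Exports.

Local Open Scope classical_set_scope.
Local Open Scope ring_scope.

(* Measurable types of the library are pointed, hence so is the metric space;
   the point is never used, and a space carrying a probability is nonempty. *)
#[short(type="pmetricType")]
HB.structure Definition PointedMetric (K : numDomainType) :=
  { M of Pointed M & Metric K M }.

HB.instance Definition _ (m : nat) := isPointed.Build 'I_m.+1 ord0.

Section probability_spaces.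
Context {R : realType}.

Definition borel (X : ptopologicalType) : measurableType _ :=
  g_sigma_algebraType (@open X).

(* The alphabet {1, ..., m} is represented by 'I_m.+1, i.e. m.+1 letters:
   a probability vector has at least one entry. *)
Definition letter_sets (m : nat) : set (set (nat -> 'I_m.+1)) :=
  [set A | exists n i, A = [set w | w n = i]].

(* one-sided shift space with its product sigma-algebra; the word
   (i_1, i_2, ...) is represented by w with w n = i_(n+1) *)
Definition words (m : nat) : measurableType _ :=
  g_sigma_algebraType (@letter_sets m).

Definition cylinder (m n : nat) (s : 'I_m.+1 ^ n) : set (words m) :=
  [set w | forall j : 'I_n, w j = s j].

(* The values on cylinders determine P, as cylinders together with set0 form a
   pi-system generating the product sigma-algebra. *)
Definition bernoulli_measure (m : nat) (p : 'I_m.+1 -> R)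
    (P : probability (words m) R) : Prop :=
  forall (n : nat) (s : 'I_m.+1 ^ n),
    P (cylinder s) = (\prod_(j < n) p (s j))%:E.

Definition measure_preserving d (T : measurableType d) (nu : set T -> \bar R)
    (F : T -> T) : Prop :=
  measurable_fun setT F /\
  forall A, measurable A -> nu (F @^-1` A) = nu A.

Definition ergodic d (T : measurableType d) (nu : set T -> \bar R)
    (F : T -> T) : Prop :=
  measure_preserving nu F /\
  forall A, measurable A -> F @^-1` A = A -> nu A = 0%E \/ nu A = 1%E.

Definition measure_support (X : ptopologicalType) (mu : set (borel X) -> \bar R)
    : set X :=
  [set x | forall U : set X, open U -> U x -> (0 < mu U)%E].

Definition full_support (X : ptopologicalType) (mu : set (borel X) -> \bar R)
    : Prop :=
  measure_support mu = setT.

End probability_spaces.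

Section semigroup_action.
Context {R : realType} {X : pmetricType R} {m : nat}.
Variable f : 'I_m.+1 -> X -> X.
Implicit Types (w v : words m) (x y : X) (k n : nat) (eps : R).

Fixpoint word_iter w n : X -> X :=
  if n is n'.+1 then f (w n') \o word_iter w n' else id.

(* The distances are nonnegative, so the default value 0 of the maximum is
   harmless when 0 < k. *)
Definition bowen_dist w k x y : R :=
  \big[Num.max/0]_(i < k) mdist (word_iter w i x) (word_iter w i y).

Definition bowen_ball w k x eps : set X :=
  [set y | bowen_dist w k x y <= eps].

Definition word_shift w : words m := fun n => w n.+1.

Definition skew_product (z : words m * borel X) : words m * borel X :=
  (word_shift z.1, word_iter z.1 1 z.2).

Section entropies.
Variable P : probability (words m) R.

Local Open Scope ereal_scope.

Definition G_ergodic (mu : probability (borel X) R) : Prop :=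
  ergodic (P \x mu) skew_product.

Definition corr_sum x eps w k n : \bar R :=
  ((n%:R ^+ 2)^-1)%:E *
  \int[P]_v (#|[pred ij : 'I_n * 'I_n |
      (bowen_dist w k (word_iter v ij.1 x) (word_iter v ij.2 x)
         <= eps)%R]|%:R)%:E.

Definition corr_sum_inf x eps w k : \bar R := limn_einf (corr_sum x eps w k).

Definition corr_sum_sup x eps w k : \bar R := limn_esup (corr_sum x eps w k).

Definition local_corr_entropy_sup x : \bar R :=
  lim (limn_esup (fun k => - ((k%:R^-1)%:E *
         \int[P]_w lne (corr_sum_inf x eps w k)))
       @[eps --> (0 : R)^'+]).

Definition local_corr_entropy_inf x : \bar R :=
  lim (limn_einf (fun k => - ((k%:R^-1)%:E *
         \int[P]_w lne (corr_sum_sup x eps w k)))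
       @[eps --> (0 : R)^'+]).

Definition mean_ball_measure (mu : probability (borel X) R) eps w k : \bar R :=
  \int[mu]_y mu (bowen_ball w k y eps).

Definition corr_entropy2_sup (mu : probability (borel X) R) : \bar R :=
  lim (limn_esup (fun k => - ((k%:R^-1)%:E *
         \int[P]_w lne (mean_ball_measure mu eps w k)))
       @[eps --> (0 : R)^'+]).

Definition corr_entropy2_inf (mu : probability (borel X) R) : \bar R :=
  lim (limn_einf (fun k => - ((k%:R^-1)%:E *
         \int[P]_w lne (mean_ball_measure mu eps w k)))
       @[eps --> (0 : R)^'+]).

End entropies.
End semigroup_action.

(* Main.v *)
Require Import Defs.
From mathcomp Require Import all_boot all_order all_algebra.
From mathcomp Require Import all_classical all_reals all_analysis.
From mathcomp Require Import measurable_realfun ring lra.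

Set Implicit Arguments.
Unset Strict Implicit.
Unset Printing Implicit Defensive.

Import Order.TTheory GRing.Theory Num.Theory.
Import numFieldNormedType.Exports.

Local Open Scope classical_set_scope.
Local Open Scope ring_scope.

(** The correlation sum is the P-average of the mass that the square of an
    empirical measure puts on the set where the Bowen distance is at most eps:
    if x_i = f_(v,i) x and the measure (delta_(x_0) + ... + delta_(x_(n-1))) / n
    is called e_n, the integrand is (e_n x e_n) {d <= eps}, while the expected
    limit is (mu x mu) {d <= eps}.  So the theorem says that the empirical
    measures of random orbits equidistribute.

    Equidistribution comes from Birkhoff's theorem [birkhoff] for the ergodic
    skew product.  It is proved for bounded functions only, which allows a
    short argument: if h has negative integral, the set of points whose
    Birkhoff sums of h are unbounded above is invariant, hence null or of full
    measure, and the maximal inequality [maximal_ergodic] excludes the latter.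
    Applied to g - (c + s) and to - g + (c - s), where c is the integral of g
    and s > 0, this traps the Birkhoff averages of g within s of c.

    The function 1_{d <= eps} is handled by discretization.  By compactness X
    is cut into finitely many Borel cells of small Bowen diameter
    ([bowen_partition]); replacing each point by the centre of its cell turns
    {d <= eps} into a finite union of products of cells, up to changing eps by
    a small amount d.  Frequencies of visits to a cell converge almost surely
    to the mass of the cell, so products of them do, and dominated convergence
    integrates this over v ([label_corr_cvg]).  Undoing the discretization
    gives, with phi eps = mean_ball_measure eps,
    - limsup C(eps) <= phi (eps + d) and phi (eps - d) <= liminf C(eps),
    for every d > 0 ([ae_corr_sum_sandwich]).  A Bowen distance sees only
    finitely many letters, so countably many such statements cover all words,
    and a single null set of points x works for all eps, w, k, d.

    Both conclusions follow.  If phi does not jump at eps, let d tend to 0;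
    the jumps of countably many monotone functions form the countable set Q.
    For the entropies take d = eps / 2: the local entropy at scale eps lies
    between the values of a monotone function of the scale at 3 eps / 2 and at
    eps / 2, so the limits at 0 agree ([lim_at_right0_sandwich]). *)

(** * Integrals and limits *)

(** The integral of a nonnegative function is a supremum over the simple
    functions below it, hence monotone on arbitrary functions.  This compares
    integrals of maps such as y |-> mu (bowen_ball f w k y e), whose
    measurability would need an argument of its own. *)
Lemma ge0_le_integralT d (T : measurableType d) (R : realType)
    (nu : {measure set T -> \bar R}) (f g : T -> \bar R) :
  (forall z, 0 <= f z)%E -> (forall z, f z <= g z)%E ->
  (\int[nu]_z f z <= \int[nu]_z g z)%E.
Proof.
move=> f0 fg; have g0 z : (0 <= g z)%E by exact: le_trans (f0 z) (fg z).
rewrite !ge0_integralTE//; apply: ereal_sup_le => _ [s sf <-].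
by exists s => // z; exact: le_trans (sf z) (fg z).
Qed.

Lemma bounded_integrable d (T : measurableType d) (R : realType)
    (nu : probability T R) (g : T -> R) (M : R) :
  measurable_fun setT g -> (forall z, `|g z| <= M) ->
  nu.-integrable setT (EFin \o g).
Proof.
move=> mg gM; apply: measurable_bounded_integrable => //.
  exact: le_lt_trans (probability_le1 nu measurableT) (ltry 1).
exists M; split => [|r Mr x _]; first exact: num_real.
exact: le_trans (gM x) (ltW Mr).
Qed.

Lemma le_limn_esup (R : realType) (u v : nat -> \bar R) :
  (forall n, u n <= v n)%E -> (limn_esup u <= limn_esup v)%E.
Proof.
move=> uv; rewrite !limn_esup_lim; apply: lee_lim; [exact: is_cvg_esups..|].
apply: nearW => n; apply: ge_ereal_sup => _ [k /= nk <-].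
by apply: le_trans (uv k) _; apply: ereal_sup_ubound; exists k.
Qed.

Lemma le_limn_einf (R : realType) (u v : nat -> \bar R) :
  (forall n, u n <= v n)%E -> (limn_einf u <= limn_einf v)%E.
Proof.
by move=> uv; rewrite /limn_einf leeN2; apply: le_limn_esup => n; rewrite leeN2.
Qed.

Lemma limn_einf_esup_cvg (R : realType) (u : nat -> \bar R) (l : \bar R) :
  (limn_esup u <= l)%E -> (l <= limn_einf u)%E -> u n @[n --> \oo] --> l.
Proof.
move=> ul lu.
have le := limn_einf_sup u.
have eI : limn_einf u = l.
  by apply/eqP; rewrite eq_le lu andbT; exact: le_trans ul.
have eS : limn_esup u = l.
  by apply/eqP; rewrite eq_le ul/=; exact: le_trans le.
apply: (@squeeze_cvge _ _ _ _ (einfs u) _ (esups u)).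
- apply: nearW => n; apply/andP; split.
    by apply: ereal_inf_lbound; exists n => /=.
  by apply: ereal_sup_ubound; exists n => /=.
- by rewrite -eI limn_einf_lim; exact: is_cvg_einfs.
- by rewrite -eS limn_esup_lim; exact: is_cvg_esups.
Qed.

Lemma ae_forall_countable d (T : measurableType d) (R : realType)
    (nu : {measure set T -> \bar R}) (I : countType) (Q : I -> T -> Prop) :
  (forall i, {ae nu, forall x, Q i x}) -> {ae nu, forall x, forall i, Q i x}.
Proof.
move=> aeQ.
have : {ae nu, forall x, forall n,
    if unpickle n is Some i then Q i x else True}.
  apply/ae_foralln => n; case: (unpickle n) => [i|]; first exact: aeQ.
  exact: aeW.
by apply: filterS => x xQ i; have := xQ (pickle i); rewrite pickleK.
Qed.

Lemma scale_at_right0 (R : realType) (c : R) : 0 < c ->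
  c * e @[e --> 0^'+] --> 0^'+.
Proof.
move=> c0 A [d /= d0 dA]; exists (d / c) => /=; first by rewrite divr_gt0.
move=> e /=; rewrite sub0r normrN => ed e0.
apply: dA; last by rewrite mulr_gt0.
by rewrite /= sub0r normrN normrM (gtr0_norm c0) mulrC -ltr_pdivlMr.
Qed.

(** A monotone H has a limit at 0, which is also the limit of e |-> H (c * e)
    for each c > 0; the cases c = 3/2 and c = 1/2 squeeze L. *)
Lemma lim_at_right0_sandwich (R : realType) (H L : R -> \bar R) :
  {homo H : a b / (a <= b) >-> (b <= a)%E} ->
  (forall e, 0 < e -> (H (e + e / 2)%R <= L e <= H (e - e / 2)%R)%E) ->
  lim (H e @[e --> 0^'+]) = lim (L e @[e --> 0^'+]).
Proof.
move=> niH HL.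
have Hl := @nonincreasing_at_right_cvge R H 0 (BInfty _ false) isT
  (fun a b _ _ => @niH a b).
have Hc c : 0 < c -> H (c * e) @[e --> 0^'+] --> lim (H e @[e --> 0^'+]).
  move=> c0; rewrite (cvg_lim _ Hl)//.
  by apply: cvg_comp Hl; exact: scale_at_right0.
apply/esym/cvg_lim => //.
apply: (@squeeze_cvge _ _ _ _
  (fun e => H (3 / 2 * e)) _ (fun e => H (2^-1 * e))).
- near=> e; have e0 : 0 < e by [].
  rewrite (_ : 3 / 2 * e = e + e / 2); last by lra.
  by rewrite (_ : 2^-1 * e = e - e / 2); [exact: HL|lra].
- by apply: Hc; rewrite divr_gt0.
- by apply: Hc; rewrite invr_gt0.
Unshelve. all: by end_near. Qed.

(** Fubini for null sets, slicing along the second factor.  The product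
    measure integrates over the first factor, hence the detour through the
    uniqueness of the product. *)
Lemma ae_product_section d1 d2 (T1 : measurableType d1) (T2 : measurableType d2)
    (R : realType) (P1 : probability T1 R) (P2 : probability T2 R)
    (Q : T1 * T2 -> Prop) :
  {ae (P1 \x P2)%E, forall z, Q z} ->
  {ae P2, forall y, {ae P1, forall x, Q (x, y)}}.
Proof.
move=> [N [mN N0 QN]].
have N0' : (\int[P2]_y P1 (ysection N y) = 0)%E.
  rewrite -N0; apply/esym.
  apply: (product_measure_unique (m1 := P1) (m2 := P2)
    (m' := (P1 \x^ P2)%E)) => // A B mA mB.
  exact: product_measure2E.
have mP : measurable_fun setT (fun y => P1 (ysection N y)).
  exact: measurable_fun_ysection.
have : ae_eq P2 setT (fun y => P1 (ysection N y)) (cst 0%E).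
  apply/(ae_eq_integral_abs P2 measurableT mP); rewrite -[RHS]N0'.
  by apply: eq_integral => y _; rewrite gee0_abs.
apply: filterS => y /= /(_ I) yN; exists (ysection N y); split => //.
  exact: measurable_ysection.
by move=> x /= nQ; rewrite /ysection/= inE; exact: QN.
Qed.

(** * Birkhoff's ergodic theorem *)

Section birkhoff_sums.
Context {d} {T : measurableType d} {R : realType}.
Implicit Types (F : T -> T) (h g : T -> R) (z : T).

Definition birkhoff_sum F h n z : R := \sum_(i < n) h (iter i F z).

(** The maximum of 0 and of the first n nonempty Birkhoff sums.  The recursion
    makes both the invariance of the set where it is unbounded and the maximal
    inequality immediate. *)
Fixpoint birkhoff_max F h n z : R :=
  if n is n'.+1 then Num.max 0 (h z + birkhoff_max F h n' (F z)) else 0.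

Lemma birkhoff_sumS F h n z :
  birkhoff_sum F h n.+1 z = h z + birkhoff_sum F h n (F z).
Proof.
rewrite /birkhoff_sum big_ord_recl/=; congr (_ + _).
by apply: eq_bigr => i _; rewrite -iterSr.
Qed.

Lemma birkhoff_max_ge0 F h n z : 0 <= birkhoff_max F h n z.
Proof. by case: n => //= n; rewrite le_max lexx. Qed.

Lemma birkhoff_max_leS F h n z :
  birkhoff_max F h n z <= birkhoff_max F h n.+1 z.
Proof.
elim: n z => [z|n IH z]; first exact: birkhoff_max_ge0.
rewrite ge_max birkhoff_max_ge0/= le_max; apply/orP; right.
by rewrite lerD2l; exact: IH.
Qed.

Lemma birkhoff_max_nd F h z :
  {homo (birkhoff_max F h)^~ z : n k / (n <= k)%N >-> n <= k}.
Proof.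
apply: homo_leq => // [? ? ?|n]; first exact: le_trans.
exact: birkhoff_max_leS.
Qed.

Lemma birkhoff_sum_le_max F h n z :
  birkhoff_sum F h n z <= birkhoff_max F h n z.
Proof.
elim: n z => [z|n IH z]; first by rewrite /birkhoff_sum big_ord0.
by rewrite birkhoff_sumS /= le_max lerD2l IH orbT.
Qed.

Lemma measurable_birkhoff_max F h n : measurable_fun setT F ->
  measurable_fun setT h -> measurable_fun setT (birkhoff_max F h n).
Proof.
move=> mF mh; elim: n => [|n IH]; first exact: measurable_cst.
apply: measurable_maxr => //; apply: measurable_funD => //.
exact: measurableT_comp.
Qed.

Lemma birkhoff_max_le F h M n z : (forall z, `|h z| <= M) ->
  `|birkhoff_max F h n z| <= M *+ n.
Proof.
move=> hM; have M0 : 0 <= M by exact: le_trans (hM z).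
rewrite ger0_norm ?birkhoff_max_ge0//.
elim: n z => [z|n IH z]; first by rewrite mulr0n.
rewrite /= ge_max mulrn_wge0//= mulrS lerD//.
exact: le_trans (ler_norm _) (hM z).
Qed.

End birkhoff_sums.

Lemma average_dist_le (R : realFieldType) (N q c s e K K' : R) :
  0 < N -> N * s <= N * (e / 2) -> K <= N * (e / 2) -> K' <= N * (e / 2) ->
  N * q <= K + N * (c + s) ->
  - (N * q) <= K' + N * (- c + s) -> `|c - q| <= e.
Proof.
move=> N0 ? ? ? ? ?; rewrite ler_norml.
by rewrite -(ler_pM2l N0) -[X in _ && X](ler_pM2l N0); apply/andP; split; lra.
Qed.

Section ergodic_theorem.
Context {d} {T : measurableType d} {R : realType}.
Variables (nu : probability T R) (F : T -> T).

Lemma measure_preserving_integral (g : T -> R) M : measure_preserving nu F ->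
  measurable_fun setT g -> (forall z, `|g z| <= M) ->
  (\int[nu]_z (g (F z))%:E = \int[nu]_z (g z)%:E)%E.
Proof.
move=> [mF nuF] mg gM.
have -> : (\int[nu]_z (g z)%:E = \int[pushforward nu F]_z (g z)%:E)%E.
  apply: eq_measure_integral => A mA _.
  exact: (esym (nuF A mA)).
rewrite (integral_pushforward mF)//; first by exact/measurable_EFinP.
apply: (bounded_integrable nu (M := M)) => //.
exact: measurableT_comp.
Qed.

(** The maximal ergodic theorem, in Garsia's form.  Write m_n for
    [birkhoff_max].  On {0 < m_n} one has m_n <= h + m_n o F, and elsewhere
    m_n - m_n o F <= 0; so m_n - m_n o F, whose integral is 0, lies below
    1_{0 < m_n} h.  The sets {0 < m_n} increase to a set of full measure. *)
Lemma maximal_ergodic (h : T -> R) M : measure_preserving nu F ->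
  measurable_fun setT h -> (forall z, `|h z| <= M) ->
  {ae nu, forall z, exists n, 0 < birkhoff_max F h n z} ->
  (0 <= \int[nu]_z (h z)%:E)%E.
Proof.
move=> pF mh hM pos; have mF := pF.1.
pose E n := [set z | 0 < birkhoff_max F h n z].
have mm n : measurable_fun setT (birkhoff_max F h n).
  exact: measurable_birkhoff_max.
have mE n : measurable (E n).
  rewrite (_ : E n = birkhoff_max F h n @^-1` `]0, +oo[%classic).
    rewrite -[X in measurable X]setTI.
    by apply: mm => //; exact: measurable_itv.
  by apply/seteqP; split => z; rewrite /= in_itv/= andbT.
pose g n z := h z * \1_(E n) z.
have mg n : measurable_fun setT (g n).
  by apply: measurable_funM => //; exact: measurable_indic.
have gM n z : `|g n z| <= M.
  rewrite /g normrM indicE; case: (_ \in _) => /=.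
    by rewrite normr1 mulr1.
  by rewrite normr0 mulr0; exact: le_trans (hM z).
have gE n : (0 <= \int[nu]_z (g n z)%:E)%E.
  have im : nu.-integrable setT (EFin \o birkhoff_max F h n).
    by apply: (bounded_integrable nu (mm n)) => z; exact: birkhoff_max_le.
  have imF : nu.-integrable setT (EFin \o (birkhoff_max F h n \o F)).
    apply: (bounded_integrable nu (M := M *+ n)) => [|z].
      exact: measurableT_comp.
    exact: birkhoff_max_le.
  have e0 :
      (\int[nu]_z (birkhoff_max F h n z - birkhoff_max F h n (F z))%:E = 0)%E.
    under eq_integral do rewrite EFinB.
    rewrite integralB// (measure_preserving_integral (M := M *+ n))//.
      rewrite subee//; exact: integrable_fin_num.
    by move=> z; exact: birkhoff_max_le.
  rewrite -e0; apply: le_integral => //.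
  - by under eq_fun do rewrite EFinB; exact: integrableB.
  - exact: (bounded_integrable nu (M := M)).
  move=> z _; rewrite lee_fin /g indicE.
  have [zE|zE] := boolP (z \in E n).
    rewrite /= mulr1 lerBlDr; move: zE; rewrite inE /E/=.
    case: n {mg gM im imF e0} => [|n]; first by rewrite /= ltxx.
    rewrite [in X in X -> _]/= lt_max ltxx/= => zE.
    rewrite [leLHS]/= (max_idPr (ltW zE)) lerD2l.
    exact: birkhoff_max_leS.
  rewrite /= mulr0 subr_le0 (le_trans _ (birkhoff_max_ge0 _ _ _ _))//.
  by rewrite leNgt; apply: contra zE => zE; rewrite inE.
have [|||||_ _ gh] := @dominated_convergence _ _ _ nu setT measurableT
  (fun n z => (g n z)%:E) (fun z => (h z)%:E) (cst M%:E).
- by move=> n; exact/measurable_EFinP.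
- exact/measurable_EFinP.
- apply: filterS pos => z [n zn] _.
  apply: cvg_near_cst; exists n => // k /= nk.
  rewrite /g indicE mem_set ?mulr1//=.
  exact: lt_le_trans zn (birkhoff_max_nd _ _ _ nk).
- apply: (bounded_integrable nu (g := cst M) (M := `|M|)) => // z.
- by apply: aeW => z n _; rewrite lee_fin.
rewrite -(cvg_lim _ gh)//; apply: lime_ge; last exact: nearW.
by apply/cvg_ex; eexists; exact: gh.
Qed.

(** The set A where the maxima are unbounded is strictly invariant, since
    passing from F z to z changes them by at most a bounded amount.  If A had
    full measure, the maximal inequality would make the integral of h
    nonnegative. *)
Lemma ergodic_birkhoff_sum_bounded (h : T -> R) M : ergodic nu F ->
  measurable_fun setT h -> (forall z, `|h z| <= M) ->
  (\int[nu]_z (h z)%:E < 0)%E ->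
  {ae nu, forall z, exists K, forall n, birkhoff_sum F h n z <= K}.
Proof.
move=> [pF erg] mh hM h0; have mF := pF.1.
pose A := [set z | forall k : nat, exists n, k%:R < birkhoff_max F h n z].
have mA : measurable A.
  rewrite (_ : A = \bigcap_k \bigcup_n
      (birkhoff_max F h n @^-1` `]k%:R, +oo[%classic)).
    apply: bigcapT_measurable => k; apply: bigcupT_measurable => n.
    rewrite -[X in measurable X]setTI.
    exact: (measurable_birkhoff_max n mF mh).
  apply/seteqP; split => [z Az k _|z Az k].
    by have [n zn] := Az k; exists n => //=; rewrite in_itv/= andbT.
  by have [n _] := Az k I; rewrite /= in_itv/= andbT; exists n.
have FA : F @^-1` A = A.
  apply/seteqP; split => z Az k;
    have := hM z; rewrite ler_norml => /andP[zM Mz];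
    have /archi_boundP : 0 <= k%:R + M
      by rewrite addr_ge0// (le_trans (normr_ge0 _) (hM z)).
    have [n zn] := Az (Num.bound (k%:R + M)) => kM; exists n.+1.
    by rewrite /= lt_max; apply/orP; right; lra.
  have [[|n]] := Az (Num.bound (k%:R + M)); first by rewrite ltNge ler0n.
  by rewrite /= lt_max ltNge ler0n/= => zn kM; exists n; lra.
have [A0|A1] := erg A mA FA.
  exists A; split => // z /= nK k; apply: contrapT => kz.
  apply: nK; exists k%:R => n; apply: le_trans (birkhoff_sum_le_max _ _ _ _) _.
  by rewrite leNgt; apply/negP => kn; apply: kz; exists n.
have : (0 <= \int[nu]_z (h z)%:E)%E.
  apply: (maximal_ergodic pF mh hM); exists (~` A); split.
  - exact: measurableC.
  - by have := probability_setC nu mA; rewrite A1 subee.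
  - by move=> z /= nz Az; apply: nz; exact: (Az 0).
by rewrite leNgt h0.
Qed.

(** Subtracting from g anything larger than its integral c makes the
    Birkhoff sums bounded above; the numbers 1 / (l + 1) serve as a countable
    family of excesses over c. *)
Lemma birkhoff_sum_le_linear (g : T -> R) M c : ergodic nu F ->
  measurable_fun setT g -> (forall z, `|g z| <= M) ->
  (\int[nu]_z (g z)%:E = c%:E)%E ->
  {ae nu, forall z, forall l : nat, exists K, forall n,
    birkhoff_sum F g n z <= K + n%:R * (c + l.+1%:R^-1)}.
Proof.
move=> eF mg gM gc; apply/ae_foralln => l.
set b := c + _.
have : {ae nu, forall z, exists K, forall n,
    birkhoff_sum F (fun z => g z - b) n z <= K}.
  apply: (ergodic_birkhoff_sum_bounded (M := M + `|b|)) => //.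
  - exact: measurable_funB.
  - by move=> z; rewrite (le_trans (ler_normB _ _))// lerD.
  under eq_integral do rewrite EFinB.
  rewrite integralB_EFin//; last 2 first.
  - exact: (bounded_integrable nu mg gM).
  - by apply: (bounded_integrable nu (g := cst b) (M := `|b|)).
  rewrite gc integral_cst//= (@probability_setT _ _ _ nu) mule1 -EFinB lte_fin.
  by rewrite /b opprD addrA subrr add0r oppr_lt0 invr_gt0.
apply: filterS => z [K zK]; exists K => n; have := zK n.
rewrite /birkhoff_sum sumrB sumr_const card_ord lerBlDr.
by rewrite mulr_natl.
Qed.

(** The linear upper bounds for g and for - g pinch the averages. *)
Theorem birkhoff (g : T -> R) M c : ergodic nu F ->
  measurable_fun setT g -> (forall z, `|g z| <= M) ->
  (\int[nu]_z (g z)%:E = c%:E)%E ->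
  {ae nu, forall z, birkhoff_sum F g n z / n%:R @[n --> \oo] --> c}.
Proof.
move=> eF mg gM gc.
have up := birkhoff_sum_le_linear eF mg gM gc.
have : {ae nu, forall z, forall l : nat, exists K, forall n,
    birkhoff_sum F (\- g) n z <= K + n%:R * (- c + l.+1%:R^-1)}.
  apply: (birkhoff_sum_le_linear (M := M)) => //.
  - exact: measurableT_comp.
  - by move=> z; rewrite normrN.
  under eq_integral do rewrite EFinN.
  rewrite integralN/= ?gc//; apply: fin_num_adde_defl; rewrite fin_numN.
  by apply: integrable_neg_fin_num => //; exact: (bounded_integrable nu mg gM).
apply: filterS2 up => z down up.
apply/cvgrPdist_le => e e0; near \oo => l.
have [K1 K1P] := down l; have [K2 K2P] := up l.
near=> n.
have n0 : 0 < n%:R :> R by rewrite ltr0n; near: n; exists 1%N.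
have ln : n%:R * l.+1%:R^-1 <= n%:R * (e / 2).
  rewrite ler_pM2l// ltW//; near: l.
  exact: (near_infty_natSinv_lt (PosNum (divr_gt0 e0 (ltr0Sn R 1)))).
have : Num.max K1 K2 <= n%:R * (e / 2).
  rewrite -ler_pdivrMr ?divr_gt0//; near: n; exact: nbhs_infty_ger.
rewrite ge_max => /andP[K1n K2n].
set q := _ / _; have Sq : birkhoff_sum F g n z = n%:R * q.
  by rewrite /q mulrC divfK// gt_eqF.
have := K1P n; have := K2P n.
have -> : birkhoff_sum F (\- g) n z = - birkhoff_sum F g n z.
  by rewrite /birkhoff_sum sumrN.
rewrite Sq => /[swap]; exact: average_dist_le.
Unshelve. all: by end_near. Qed.

End ergodic_theorem.

(** * Finite partitions and pair counts *)

Lemma label_sumE (Y : Type) (R : realType) (I : finType) (lab : Y -> I)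
    (s : I -> R) y : s (lab y) = \sum_a s a * \1_(lab @^-1` [set a]) y.
Proof.
rewrite (bigD1 (lab y))//= indicE mem_set//= mulr1 big1 ?addr0// => a ay.
by rewrite indicE memNset ?mulr0//= => ya; rewrite ya eqxx in ay.
Qed.

Section labels.
Context {d} {Y : measurableType d} {R : realType} {I : finType}.
Variables (mu : probability Y R) (lab : Y -> I).
Hypothesis mlab : forall a, measurable (lab @^-1` [set a]).

Definition label_prob a : R := fine (mu (lab @^-1` [set a])).

Lemma integral_label (s : I -> R) :
  (\int[mu]_y (s (lab y))%:E = (\sum_a s a * label_prob a)%:E)%E.
Proof.
under eq_integral do rewrite label_sumE -sumEFin.
have mind a : measurable_fun setT (\1_(lab @^-1` [set a]) : Y -> R).
  exact: measurable_indic.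
rewrite integral_sum//; last first.
  move=> a; apply: (bounded_integrable mu (M := `|s a|)) => [|y].
    exact: measurable_funM.
  by rewrite normrM ler_piMr// indicE normr_nat; case: (_ \in _).
rewrite -sumEFin; apply: eq_bigr => a _.
under eq_integral do rewrite EFinM.
rewrite integralZl//; last first.
  apply: (bounded_integrable mu (M := 1)) => // y.
  by rewrite indicE normr_nat; case: (_ \in _).
by rewrite integral_indic// setIT EFinM fineK// fin_num_measure.
Qed.

Lemma measurable_label_rel (r : rel I) a : measurable [set y | r a (lab y)].
Proof.
rewrite (_ : mkset _ = \bigcup_(b in [set b | r a b]) (lab @^-1` [set b])).
  by apply: fin_bigcup_measurable => //; exact: finite_finset.
by apply/seteqP; split => [y ay|y [b /= ab ->]] //; exists (lab y).
Qed.

Lemma measure_label_rel (r : rel I) a :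
  mu [set y | r a (lab y)] = (\sum_b (r a b)%:R * label_prob b)%:E.
Proof.
rewrite -(integral_label (fun b => (r a b)%:R)).
transitivity (\int[mu]_y (\1_[set z | r a (lab z)] y)%:E)%E.
  by rewrite integral_indic ?setIT//; exact: measurable_label_rel.
apply: eq_integral => y _; rewrite indicE.
suff -> : (y \in [set z | r a (lab z)]) = r a (lab y) by [].
by apply/idP/idP; rewrite inE.
Qed.

(** For a probability vector q, the mass that the product q x q gives to the
    relation r. *)
Definition pair_mass (r : rel I) (q : I -> R) : R :=
  \sum_a (\sum_b (r a b)%:R * q b) * q a.

Lemma integral_measure_label_rel (r : rel I) :
  (\int[mu]_x mu [set y | r (lab x) (lab y)] = (pair_mass r label_prob)%:E)%E.
Proof.
under eq_integral do rewrite measure_label_rel.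
exact: (integral_label (fun a => \sum_b (r a b)%:R * label_prob b)).
Qed.

End labels.

(** The i-th visited point is y i; for n = 0 the value is 0, consistently with
    the correlation sums. *)
Definition label_freq (Y : Type) (R : realType) (I : finType) (lab : Y -> I)
    (y : nat -> Y) n a : R :=
  (\sum_(i < n) \1_(lab @^-1` [set a]) (y i)) / n%:R.

(** The proportion of pairs of times in relation r is the product mass of r
    for the empirical distribution of the labels. *)
Lemma card_pair_mass (Y : Type) (R : realType) (I : finType) (lab : Y -> I)
    (r : rel I) (y : nat -> Y) n :
  ((n%:R ^+ 2)^-1 *
    #|[pred ij : 'I_n * 'I_n | r (lab (y ij.1)) (lab (y ij.2))]|%:R
  = pair_mass r (label_freq R lab y n)).
Proof.
pose count a : R := \sum_(i < n) \1_(lab @^-1` [set a]) (y i).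
have sumE (s : I -> R) : \sum_(i < n) s (lab (y i)) = \sum_a s a * count a.
  under eq_bigr do rewrite label_sumE; rewrite exchange_big/=.
  by under eq_bigr do rewrite -mulr_sumr.
rewrite -sum1_card natr_sum.
pose r' (i j : 'I_n) := r (lab (y i)) (lab (y j)).
rewrite (eq_bigl (fun ij : 'I_n * 'I_n => true && r' ij.1 ij.2))//.
rewrite -(pair_big_dep xpredT r' (fun _ _ => 1)).
have inner (i : 'I_n) :
    \sum_(j < n | r' i j) 1 = \sum_b (r (lab (y i)) b)%:R * count b :> R.
  rewrite -(sumE (fun b => (r (lab (y i)) b)%:R)) [LHS]big_mkcond/=.
  by apply: eq_bigr => j _; rewrite /r'; case: (r _ _).
under eq_bigr do rewrite inner.
rewrite (sumE (fun a => \sum_b (r a b)%:R * count b)) mulr_sumr.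
rewrite /pair_mass /count; apply: eq_bigr => a _; rewrite /label_freq.
under [in RHS]eq_bigr do rewrite mulrA.
rewrite -mulr_suml expr2 invfM.
by ring.
Qed.

Lemma pair_mass_cvg (R : realType) (I : finType) (r : rel I)
    (q_ : nat -> I -> R) (q : I -> R) :
  (forall a, q_ n a @[n --> \oo] --> q a) ->
  pair_mass r (q_ n) @[n --> \oo] --> pair_mass r q.
Proof.
move=> qq; apply: cvg_big => [|a _]; first exact: add_continuous.
apply: cvgM => //; apply: cvg_big => [|b _]; first exact: add_continuous.
by apply: cvgM => //; exact: cvg_cst.
Qed.

(** * Visit frequencies of random orbits *)

Section orbits.
Context {R : realType} {X : pmetricType R} {m : nat}.
Variables (f : 'I_m.+1 -> X -> X) (P : probability (words m) R)
  (mu : probability (borel X) R).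

Lemma iter_skew_product n (v : words m) (x : X) :
  iter n (skew_product f) (v, x) =
    ((fun i => v (n + i)%N) : words m, word_iter f v n x).
Proof.
elim: n => [//|n IH]; rewrite iterS IH /skew_product/= addn0; congr (_, _).
by apply/funext => i; rewrite /word_shift addnS addSn.
Qed.

Hypothesis mskew : measurable_fun setT (skew_product f).

(** The skew product is measurable for the product sigma-algebra, so a random
    orbit is read off its iterates. *)
Lemma measurable_word_iter n (x : X) :
  measurable_fun setT (fun v : words m => word_iter f v n x : borel X).
Proof.
have -> : (fun v : words m => word_iter f v n x : borel X) =
    snd \o iter n (skew_product f) \o (fun v => (v, x : borel X)).
  by apply/funext => v /=; rewrite iter_skew_product.
apply: measurableT_comp; last exact: measurable_fun_pair.
apply: measurableT_comp => //.
elim: n => [|n IH] //=; first exact: measurable_id.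
exact: measurableT_comp.
Qed.

Context {I : finType} (lab : X -> I).
Hypothesis mlab : forall a, measurable (lab @^-1` [set a] : set (borel X)).

Lemma measurable_label_freq (x : X) n a :
  measurable_fun setT
    (fun v : words m => label_freq R lab (fun i => word_iter f v i x) n a).
Proof.
apply: measurable_funM => //; apply: measurable_sum => i.
have mi : measurable_fun setT (\1_(lab @^-1` [set a]) : borel X -> R).
  exact: measurable_indic.
exact: (measurableT_comp mi (measurable_word_iter i x)).
Qed.

Lemma measurable_pair_freq (x : X) (r : rel I) n :
  measurable_fun setT (fun v : words m =>
    pair_mass r (label_freq R lab (fun i => word_iter f v i x) n)).
Proof.
apply: measurable_sum => a; apply: measurable_funM;
  last exact: measurable_label_freq.
apply: measurable_sum => b; apply: measurable_funM => //.
exact: measurable_label_freq.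
Qed.

(** Visits to a cell are Birkhoff sums, for the skew product, of a function of
    the second coordinate. *)
Lemma label_freq_cvg : G_ergodic f P mu ->
  {ae mu, forall x, {ae P, forall v, forall a,
    label_freq R lab (fun i => word_iter f v i x) n a @[n --> \oo]
      --> label_prob mu lab a}}.
Proof.
move=> erg.
have freqa (a : I) : {ae mu, forall x, {ae P, forall v,
    label_freq R lab (fun i => word_iter f v i x) n a @[n --> \oo]
      --> label_prob mu lab a}}.
  have mi : measurable_fun setT (\1_(lab @^-1` [set a]) : borel X -> R).
    exact: measurable_indic.
  pose visits := birkhoff_sum (skew_product f)
    (fun z => \1_(lab @^-1` [set a]) z.2 : R).
  have /ae_product_section : {ae (P \x mu)%E, forall z,
      visits n z / n%:R @[n --> \oo] --> label_prob mu lab a}.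
    apply: (birkhoff (M := 1)) => //.
    - exact: (measurableT_comp mi measurable_snd).
    - by move=> z; rewrite indicE normr_nat; case: (_ \in _).
    transitivity (\int[(P \x mu)%E]_z (\1_(setT `*` lab @^-1` [set a]) z)%:E)%E.
      by apply: eq_integral => z _; rewrite !indicE in_setX in_setT.
    rewrite integral_indic// ?setIT; last exact: measurableX.
    transitivity (P setT * mu (lab @^-1` [set a]))%E.
      exact: (product_measure1E _ _ measurableT (mlab a)).
    rewrite (@probability_setT _ _ _ P) mul1e.
    by rewrite fineK// fin_num_measure.
  apply: filterS => x; apply: filterS => v.
  suff -> : (fun n => label_freq R lab (fun i => word_iter f v i x) n a) =
      (fun n => visits n (v, x) / n%:R) by [].
  apply/funext => n; congr (_ / _).
  by apply: eq_bigr => i _; rewrite iter_skew_product.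
have /filter_forall : forall a, {ae mu, forall x, {ae P, forall v,
    label_freq R lab (fun i => word_iter f v i x) n a @[n --> \oo]
      --> label_prob mu lab a}} by [].
by apply: filterS => x /filter_forall.
Qed.

(** Dominated convergence over v: the proportion of pairs of times in relation
    r is at most 1 and converges for almost every v. *)
Lemma label_corr_cvg (x : X) (r : rel I) :
  {ae P, forall v, forall a,
    label_freq R lab (fun i => word_iter f v i x) n a @[n --> \oo]
      --> label_prob mu lab a} ->
  (((n%:R ^+ 2)^-1)%:E * \int[P]_v (#|[pred ij : 'I_n * 'I_n |
     r (lab (word_iter f v ij.1 x)) (lab (word_iter f v ij.2 x))]|%:R)%:E)%E
    @[n --> \oo] --> (pair_mass r (label_prob mu lab))%:E.
Proof.
move=> freq.
pose C n (v : words m) : R :=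
  pair_mass r (label_freq R lab (fun i => word_iter f v i x) n).
have CE n v : C n v = (n%:R ^+ 2)^-1 * #|[pred ij : 'I_n * 'I_n |
     r (lab (word_iter f v ij.1 x)) (lab (word_iter f v ij.2 x))]|%:R.
  by rewrite (card_pair_mass R lab r (fun i => word_iter f v i x)).
have mC n : measurable_fun setT (C n) by exact: measurable_pair_freq.
have C1 n v : `|C n v| <= 1.
  rewrite CE ger0_norm ?mulr_ge0//.
  have [->|n0] := eqVneq n 0%N; first by rewrite expr0n/= invr0 mul0r.
  rewrite mulrC ler_pdivrMr ?mul1r ?exprn_gt0 ?ltr0n ?lt0n// -natrX ler_nat.
  by rewrite (leq_trans (max_card _))// card_prod !card_ord.
have -> : (fun n => ((n%:R ^+ 2)^-1)%:E * \int[P]_v (#|[pred ij : 'I_n * 'I_n |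
     r (lab (word_iter f v ij.1 x)) (lab (word_iter f v ij.2 x))]|%:R)%:E)%E
   = (fun n => \int[P]_v (C n v)%:E)%E.
  apply/funext => n.
  have iC : P.-integrable setT (EFin \o C n).
    exact: (bounded_integrable P (mC n) (C1 n)).
  have [->|n0] := eqVneq n 0%N.
    rewrite expr0n/= invr0 mul0e; apply/esym/integral0_eq => v _.
    by rewrite CE expr0n/= invr0 mul0r.
  under eq_integral do rewrite -[X in X%:E](mulVKf (x := n%:R ^+ 2))
    ?sqrf_eq0 ?pnatr_eq0// -CE EFinM.
  by rewrite integralZl// muleA -EFinM mulVf ?mul1e// sqrf_eq0 pnatr_eq0.
have [|||||_ _] := @dominated_convergence _ _ _ P setT measurableT
  (fun n v => (C n v)%:E) (cst (pair_mass r (label_prob mu lab))%:E) (cst 1%E).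
- by move=> n; exact/measurable_EFinP.
- exact: measurable_cst.
- apply: filterS freq => v fv _; apply: cvg_EFin; first exact: nearW.
  exact: pair_mass_cvg.
- apply: (bounded_integrable P (g := cst 1) (M := 1)) => // z.
  by rewrite normr1.
- by apply: aeW => v n _; rewrite lee_fin C1.
by rewrite integral_cst//= (@probability_setT _ _ _ P) mule1.
Qed.

End orbits.

(** * Bowen distances and partitions of small diameter *)

Section bowen_geometry.
Context {R : realType} {X : pmetricType R} {m : nat}.
Variable f : 'I_m.+1 -> X -> X.
Implicit Types (w : words m) (x y z : X) (k : nat) (e : R).

Lemma bowen_dist_leP w k x y e : 0 <= e ->
  reflect (forall i : 'I_k, mdist (word_iter f w i x) (word_iter f w i y) <= e)
    (bowen_dist f w k x y <= e).
Proof.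
move=> e0; apply: (iffP (bigmax_leP _ _ _ _)) => [[_ h] i|h]; first exact: h.
by split.
Qed.

Lemma bowen_dist_ge0 w k x y : 0 <= bowen_dist f w k x y.
Proof. exact: bigmax_ge_id. Qed.

Lemma bowen_distxx w k x : bowen_dist f w k x x = 0.
Proof.
apply/eqP; rewrite eq_le bowen_dist_ge0 andbT.
by apply/bowen_dist_leP => // i; rewrite mdistxx.
Qed.

Lemma bowen_dist_sym w k x y : bowen_dist f w k x y = bowen_dist f w k y x.
Proof. by apply: eq_bigr => i _; rewrite metric_sym. Qed.

Lemma bowen_dist_triangle w k x y z :
  bowen_dist f w k x z <= bowen_dist f w k x y + bowen_dist f w k y z.
Proof.
apply/bowen_dist_leP => [|i]; first by rewrite addr_ge0 ?bowen_dist_ge0.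
apply: le_trans (metric_triangle _ (word_iter f w i y) _) _.
have le_bowen u v : mdist (word_iter f w i u) (word_iter f w i v) <=
    bowen_dist f w k u v.
  exact: (elimT (bowen_dist_leP _ _ _ _ (bowen_dist_ge0 _ _ _ _)) (lexx _)).
by rewrite lerD.
Qed.

(** Reduces statements about all words to countably many. *)
Lemma eq_bowen_dist w w' k x y : (forall i, (i < k)%N -> w i = w' i) ->
  bowen_dist f w k x y = bowen_dist f w' k x y.
Proof.
move=> ww'; have wi i : (i <= k)%N -> word_iter f w i =1 word_iter f w' i.
  elim: i => [//|i IH] ik z /=.
  by rewrite ww'// IH// ltnW.
by apply: eq_bigr => i _; rewrite !wi// ltnW.
Qed.

Hypothesis fc : forall i, continuous (f i).

Lemma continuous_word_iter w n : continuous (word_iter f w n).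
Proof.
elim: n => [|n IH] x /=; first exact: cvg_id.
by apply: continuous_comp; [exact: IH|exact: fc].
Qed.

Lemma open_bowen_ball w k x e : 0 < e ->
  open [set y | bowen_dist f w k x y < e].
Proof.
move=> e0; rewrite openE => y /= xy.
pose d := e - bowen_dist f w k x y; have d0 : 0 < d by rewrite subr_gt0.
have : \forall z \near y, forall i : 'I_k,
    mdist (word_iter f w i y) (word_iter f w i z) < d.
  apply: filter_forall => i.
  have := @continuous_word_iter w i y (ball (word_iter f w i y) d).
  move=> /(_ (nbhsx_ballx _ _ d0)).
  by rewrite /nbhs/= ballEmdist.
apply: filterS => z yz.
apply: le_lt_trans (bowen_dist_triangle _ _ _ y _) _.
rewrite -ltrBrDl; apply/bigmax_ltP; split => // i _; exact: yz.
Qed.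

Lemma closed_bowen_ball w k x e : closed (bowen_ball f w k x e).
Proof.
rewrite -openC openE => y /= /negP; rewrite -ltNge => xy.
pose d := bowen_dist f w k x y - e; have d0 : 0 < d by rewrite subr_gt0.
have := @open_bowen_ball w k y d d0; rewrite openE => /(_ y).
rewrite /= bowen_distxx => /(_ d0).
apply: filterS => z /= yz; apply/negP; rewrite -ltNge.
have := bowen_dist_triangle w k x z y; rewrite (bowen_dist_sym w k z y).
rewrite /d in yz; lra.
Qed.

Lemma measurable_bowen_ball w k x e :
  measurable (bowen_ball f w k x e : set (borel X)).
Proof.
rewrite -[X in measurable X]setCK; apply: measurableC.
apply: sub_sigma_algebra; exact/closed_openC/closed_bowen_ball.
Qed.

(** Compactness gives finitely many centres with Bowen balls covering X; each
    point is labelled by the first centre within distance e. *)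
Lemma bowen_partition w k e : compact [set: X] -> 0 < e ->
  exists (N : nat) (c : 'I_N -> X) (lab : X -> 'I_N),
    (forall a, measurable (lab @^-1` [set a] : set (borel X))) /\
    (forall y, bowen_dist f w k (c (lab y)) y <= e).
Proof.
rewrite compact_cover => cX e0.
have [|x _|D _ DX] := cX X setT (fun x => [set y | bowen_dist f w k x y < e]).
- by move=> x _; exact: open_bowen_ball.
- by exists x => //=; rewrite bowen_distxx.
pose s := finmap.enum_fset D; pose p y := fun c => bowen_dist f w k c y <= e.
pose lab y : 'I_(size s).+1 := inord (find (p y) s).
have labE y : lab y = find (p y) s :> nat by rewrite inordK// ltnS find_size.
(* The label size s stands for the case in which no centre is found; its
   cell is empty. *)
exists (size s).+1, (fun a => nth point s a), lab; split => [a|y]; last first.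
  rewrite labE; apply: (@nth_find _ point (p y)); apply/hasP.
  by have [c /= cD cy] := DX y I; exists c => //; exact: ltW.
have -> : lab @^-1` [set a] = [set y | find (p y) s = a :> nat].
  by apply/seteqP; split => y /=; rewrite -labE; [move=> ->|exact: val_inj].
move: (nat_of_ord a) => n {a lab labE DX}.
elim: s n => [|c s IH] [|n] /=.
- by rewrite (_ : mkset _ = setT)//; apply/seteqP; split.
- by rewrite (_ : mkset _ = set0)//; apply/seteqP; split.
- rewrite (_ : mkset _ = bowen_ball f w k c e).
    exact: measurable_bowen_ball.
  by apply/seteqP; split => y /=; rewrite /p /bowen_ball/=; case: ifP.
rewrite (_ : mkset _ = ~` bowen_ball f w k c e `&` [set y | find (p y) s = n]).
  apply: measurableI (IH n); apply: measurableC.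
  exact: measurable_bowen_ball.
apply/seteqP; split => y /=; rewrite /bowen_ball /= -/(p y c);
  case: (p y c) => //=.
- by move=> [<-].
- by move=> [].
- by move=> [_ ->].
Qed.

End bowen_geometry.

(** * Comparing correlation sums with mean ball measures *)

Section mean_ball.
Context {R : realType} {X : pmetricType R} {m : nat}.
Variables (f : 'I_m.+1 -> X -> X) (P : probability (words m) R)
  (mu : probability (borel X) R).
Hypothesis fc : forall i, continuous (f i).

Let phi eps w k := mean_ball_measure f mu eps w k.

Lemma mean_ball_measure_ge0 eps w k : (0 <= phi eps w k)%E.
Proof. by apply: integral_ge0. Qed.

Lemma mean_ball_measure_le1 eps w k : (phi eps w k <= 1)%E.
Proof.
rewrite -[leRHS](@probability_setT _ _ _ mu) -[leRHS]mul1e -integral_cst//.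
apply: ge0_le_integralT => // y; apply: probability_le1.
exact: measurable_bowen_ball.
Qed.

Lemma mean_ball_measure_nd w k e e' : e <= e' -> (phi e w k <= phi e' w k)%E.
Proof.
move=> ee'; apply: ge0_le_integralT => // y; apply: le_measure.
- by rewrite inE; exact: measurable_bowen_ball.
- by rewrite inE; exact: measurable_bowen_ball.
by move=> z /= /le_trans; apply.
Qed.

(** Let the cells have centres c and Bowen radius at most d, and relate two
    labels when their centres are within a given distance.  Passing between
    points and centres costs 2 d on each side, once for orbit pairs and once
    for mu x mu, whence 4 d. *)
Lemma corr_sum_sandwich w k d : compact [set: X] -> G_ergodic f P mu -> 0 < d ->
  {ae mu, forall x, forall eps,
    (limn_esup (corr_sum f P x eps w k) <= phi (eps + 4 * d) w k)%E /\
    (phi (eps - 4 * d) w k <= limn_einf (corr_sum f P x eps w k))%E}.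
Proof.
move=> cX erg d0.
have [N [c [lab [mlab labd]]]] := bowen_partition fc w k cX d0.
pose r e : rel 'I_N := fun a b => bowen_dist f w k (c a) (c b) <= e.
have rP e y z : bowen_dist f w k y z <= e -> r (e + 2 * d) (lab y) (lab z).
  move=> yz; rewrite /r.
  have := bowen_dist_triangle f w k (c (lab y)) y (c (lab z)).
  have := bowen_dist_triangle f w k y z (c (lab z)).
  have := labd y; have := labd z; rewrite (bowen_dist_sym f w k z (c _)).
  lra.
have Pr e y z : r e (lab y) (lab z) -> bowen_dist f w k y z <= e + 2 * d.
  rewrite /r => yz.
  have := bowen_dist_triangle f w k y (c (lab y)) z.
  have := bowen_dist_triangle f w k (c (lab y)) (c (lab z)) z.
  have := labd y; have := labd z; rewrite (bowen_dist_sym f w k y (c _)).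
  lra.
have [mF _] := erg.1.
have freq := label_freq_cvg mlab erg.
have aeF : Filter (nbhs (almost_everywhere mu)).
  exact: ae_filter_ringOfSetsType.
apply: filterS freq => x xfreq eps.
have Gl e := cvg_limn_einf_sup (label_corr_cvg mF mlab (r := r e) xfreq).
have le_corr (D D' : X -> X -> bool) n : (forall y z, D y z -> D' y z) ->
    (((n%:R ^+ 2)^-1)%:E * \int[P]_v (#|[pred ij : 'I_n * 'I_n |
     D (word_iter f v ij.1 x) (word_iter f v ij.2 x)]|%:R)%:E <=
    ((n%:R ^+ 2)^-1)%:E * \int[P]_v (#|[pred ij : 'I_n * 'I_n |
     D' (word_iter f v ij.1 x) (word_iter f v ij.2 x)]|%:R)%:E)%E.
  move=> DD'; apply: lee_wpmul2l; first by rewrite lee_fin.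
  apply: ge0_le_integralT => v; first by rewrite lee_fin.
  rewrite lee_fin ler_nat; apply: subset_leq_card.
  by apply/fintype.subsetP => ij; exact: DD'.
split.
  apply: (@le_trans _ _ (pair_mass (r (eps + 2 * d)) (label_prob mu lab))%:E).
    rewrite -(Gl _).2; apply: le_limn_esup => n.
    apply: (le_corr (fun y z => bowen_dist f w k y z <= eps)
              (fun y z => r (eps + 2 * d) (lab y) (lab z))).
    exact: rP.
  rewrite -(integral_measure_label_rel mu mlab).
  apply: ge0_le_integralT => // y; apply: le_measure.
  - by rewrite inE; exact: (measurable_label_rel mlab).
  - by rewrite inE; exact: measurable_bowen_ball.
  move=> z /= /Pr; rewrite /bowen_ball/=; lra.
apply: (@le_trans _ _ (pair_mass (r (eps - 2 * d)) (label_prob mu lab))%:E).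
  rewrite -(integral_measure_label_rel mu mlab).
  apply: ge0_le_integralT => // y; apply: le_measure.
  - by rewrite inE; exact: measurable_bowen_ball.
  - by rewrite inE; exact: (measurable_label_rel mlab).
  move=> z /= /rP; congr (r _ _ _); lra.
rewrite -(Gl _).1; apply: le_limn_einf => n.
apply: (le_corr (fun y z => r (eps - 2 * d) (lab y) (lab z))
          (fun y z => bowen_dist f w k y z <= eps)).
move=> y z /Pr; lra.
Qed.

(** Padding with the letter 0 gives a countable set of representatives. *)
Definition finite_word (s : seq 'I_m.+1) : words m := fun i => nth ord0 s i.

Lemma bowen_dist_finite_word w k :
  bowen_dist f w k = bowen_dist f (finite_word (mkseq w k)) k.
Proof.
apply/funext => x; apply/funext => y; apply: eq_bowen_dist => i ik.
by rewrite /finite_word nth_mkseq.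
Qed.

(** One null set for all parameters: words reduce to finite words, radii d to
    the numbers 4 / (l + 1), and the scale eps was already uniform. *)
Lemma ae_corr_sum_sandwich : compact [set: X] -> G_ergodic f P mu ->
  {ae mu, forall x, forall w k eps d, 0 < d ->
    (limn_esup (corr_sum f P x eps w k) <= phi (eps + d) w k)%E /\
    (phi (eps - d) w k <= limn_einf (corr_sum f P x eps w k))%E}.
Proof.
move=> cX erg.
have : {ae mu, forall x, forall skl : seq 'I_m.+1 * nat * nat, forall eps,
    let: (s, k, l) := skl in
    (limn_esup (corr_sum f P x eps (finite_word s) k)
       <= phi (eps + 4 * l.+1%:R^-1) (finite_word s) k)%E /\
    (phi (eps - 4 * l.+1%:R^-1) (finite_word s) k
       <= limn_einf (corr_sum f P x eps (finite_word s) k))%E}.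
  apply: ae_forall_countable => -[[s k] l].
  by apply: corr_sum_sandwich => //; rewrite invr_gt0.
have aeF : Filter (nbhs (almost_everywhere mu)).
  exact: ae_filter_ringOfSetsType.
apply: filterS => x xQ w k eps d d0.
have corrE :
    corr_sum f P x eps w k = corr_sum f P x eps (finite_word (mkseq w k)) k.
  by rewrite /corr_sum bowen_dist_finite_word.
have phiE e : phi e w k = phi e (finite_word (mkseq w k)) k.
  by rewrite /phi /mean_ball_measure /bowen_ball bowen_dist_finite_word.
near \oo => l.
have [up down] := xQ (mkseq w k, k, l) eps.
have ld : 4 * l.+1%:R^-1 <= d.
  rewrite mulrC -ler_pdivlMr// ltW//; near: l.
  exact: (near_infty_natSinv_lt (PosNum (divr_gt0 d0 (ltr0Sn R 3)))).
rewrite corrE !phiE; split.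
  by apply: le_trans up _; apply: mean_ball_measure_nd; rewrite lerD2l.
by apply: le_trans down; apply: mean_ball_measure_nd; rewrite lerD2l lerN2.
Unshelve. all: by end_near. Qed.

End mean_ball.

(** * Jumps of monotone functions *)

(** The points at which phi jumps across the rational q. *)
Definition jump_set {R : realType} (phi : R -> \bar R) (q : rat) : set R :=
  [set e | forall d, 0 < d -> (phi (e - d)%R < (ratr q)%:E < phi (e + d)%R)%E].

(** The midpoint of two jumps e < e' would lie above q because of e and
    below q because of e'. *)
Lemma jump_set_unique (R : realType) (phi : R -> \bar R) q e e' :
  jump_set phi q e -> jump_set phi q e' -> e = e'.
Proof.
wlog ee' : e e' / e < e' => [wlogH je je'|je je'].
  have [ee'|ee'|//] := ltgtP e e'; first exact: wlogH.
  by apply/esym/wlogH.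
have d0 : 0 < (e' - e) / 2 by rewrite divr_gt0// subr_gt0.
have /andP[_] := je _ d0; have /andP[+ _] := je' _ d0.
rewrite (_ : e' - (e' - e) / 2 = e + (e' - e) / 2); last by lra.
by move=> /lt_trans /[apply]; rewrite ltxx.
Qed.

Lemma countable_jump_set (R : realType) (phi : R -> \bar R) q :
  countable (jump_set phi q).
Proof.
have [[e je]|nj] := pselect (exists e, jump_set phi q e); last first.
  rewrite (_ : jump_set _ _ = set0)//; apply/seteqP; split => // e je.
  by apply: nj; exists e.
apply: sub_countable (countable1 e); apply: subset_card_le => e' je'.
exact: jump_set_unique je' je.
Qed.

(** If hi were above phi e, a rational q strictly between them would separate
    phi (e - d) from phi (e + d) for every d; similarly for lo. *)
Lemma sandwich_outside_jump_set (R : realType) (phi : R -> \bar R)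
    (lo hi : \bar R) (e : R) :
  {homo phi : a b / (a <= b) >-> (a <= b)%E} ->
  (forall a, (0 <= phi a <= 1)%E) ->
  (forall d : R, 0 < d -> (hi <= phi (e + d)%R)%E /\ (phi (e - d)%R <= lo)%E) ->
  (forall q, ~ jump_set phi q e) ->
  (hi <= phi e)%E /\ (phi e <= lo)%E.
Proof.
move=> ndphi phi01 sandwich nj.
have dens (a b : \bar R) : (0 <= a)%E -> (b <= 1)%E -> (a < b)%E ->
    exists q : rat, (a < (ratr q)%:E < b)%E.
  case: a => [a| |]//; case: b => [b| |]// _ _; rewrite lte_fin => ab.
  have [q] := rat_in_itvoo ab; rewrite in_itv/= => qab.
  by exists q; rewrite !lte_fin.
split; rewrite leNgt; apply/negP => lt.
  have hi1 : (hi <= 1)%E.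
    by apply: le_trans (sandwich 1 ltr01).1 _; have /andP[] := phi01 (e + 1).
  have [|q /andP[eq qhi]] := dens _ _ _ hi1 lt.
    by have /andP[] := phi01 e.
  apply: (nj q) => d d0; apply/andP; split.
    by apply: le_lt_trans eq; apply: ndphi; rewrite gerBl ltW.
  exact: lt_le_trans qhi (sandwich _ d0).1.
have lo0 : (0 <= lo)%E.
  by apply: le_trans (sandwich 1 ltr01).2; have /andP[] := phi01 (e - 1).
have [|q /andP[loq qe]] := dens _ _ lo0 _ lt.
  by have /andP[] := phi01 e.
apply: (nj q) => d d0; apply/andP; split.
  exact: le_lt_trans (sandwich _ d0).2 loq.
by apply: lt_le_trans qe _; apply: ndphi; rewrite lerDl ltW.
Qed.

(** * Entropies *)

(** The order is reversed by the sign; since lne takes nonpositive values here,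
    the comparison reduces to nonnegative integrands. *)
Lemma le_mean_log (d : measure_display) (T : measurableType d) (R : realType)
    (P : probability T R) (u v : T -> \bar R) (k : nat) :
  (forall w, 0 <= u w)%E -> (forall w, u w <= v w)%E ->
  (forall w, v w <= 1)%E ->
  (- ((k%:R^-1)%:E * \int[P]_w lne (v w)) <=
   - ((k%:R^-1)%:E * \int[P]_w lne (u w)))%E.
Proof.
move=> u0 uv v1; rewrite leeN2; apply: lee_wpmul2l; first by rewrite lee_fin.
have lneN (g : T -> \bar R) : (forall w, g w <= 1)%E ->
    (\int[P]_w lne (g w) = - \int[P]_w - lne (g w))%E.
  move=> g1; rewrite -integral_ge0N => [|w _]; last by rewrite oppe_ge0 lne_le0.
  by apply: eq_integral => w _; rewrite oppeK.
have v0 w : (0 <= v w)%E by exact: le_trans (u0 w) (uv w).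
have u1 w : (u w <= 1)%E by exact: le_trans (uv w) (v1 w).
rewrite (lneN u)// (lneN v)//.
rewrite leeN2; apply: ge0_le_integralT => w; first by rewrite oppe_ge0 lne_le0.
by rewrite leeN2 lee_lne// in_itv/= ?u0 ?v0 leey.
Qed.

Theorem theorem1p1 (R : realType) (X : pmetricType R) (m : nat)
    (f : 'I_m.+1 -> X -> X) (p : 'I_m.+1 -> R)
    (P : probability (words m) R) (mu : probability (borel X) R) :
  compact [set: X] ->
  (forall i, continuous (f i)) ->
  (forall i, 0 < p i) ->
  \sum_(i < m.+1) p i = 1 ->
  bernoulli_measure p P ->
  G_ergodic f P mu ->
  full_support mu ->
  (exists Q : set R, countable Q /\
     forall eps : R, 0 < eps -> ~ Q eps ->
     forall (w : words m) (k : nat), (0 < k)%N ->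
       {ae mu, forall x : X,
         corr_sum f P x eps w k n @[n --> \oo]
           --> (\int[mu]_y mu (bowen_ball f w k y eps))%E})
  /\
  {ae mu, forall x : X,
    corr_entropy2_sup f P mu = local_corr_entropy_sup f P x /\
    corr_entropy2_inf f P mu = local_corr_entropy_inf f P x}.
Proof.
move=> cX fc _ _ _ erg _.
have aeF : Filter (nbhs (almost_everywhere mu)).
  exact: ae_filter_ringOfSetsType.
have sandwich := ae_corr_sum_sandwich fc cX erg.
pose phi eps w k := mean_ball_measure f mu eps w k.
have phi_nd w k e e' : e <= e' -> (phi e w k <= phi e' w k)%E.
  exact: mean_ball_measure_nd.
have phi01 w k e : (0 <= phi e w k <= 1)%E.
  by rewrite mean_ball_measure_ge0 mean_ball_measure_le1.
split.
  exists (\bigcup_(i in [set: seq 'I_m.+1 * nat * rat])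
    jump_set (fun e => phi e (finite_word i.1.1) i.1.2) i.2); split.
    apply: bigcup_countable => [|[[s k] q] _]; first exact: countableP.
    exact: countable_jump_set.
  move=> eps _ nQ w k _; apply: filterS sandwich => x xS.
  have [|up down] := @sandwich_outside_jump_set R (fun e => phi e w k)
    (corr_sum_inf f P x eps w k) (corr_sum_sup f P x eps w k) eps
    (phi_nd w k) (phi01 w k) (xS w k eps).
    move=> q jq; apply: nQ; exists (mkseq w k, k, q) => //=.
    suff -> : (fun e => phi e (finite_word (mkseq w k)) k) =
        (fun e => phi e w k) by [].
    apply/funext => e; rewrite /phi /mean_ball_measure /bowen_ball.
    by rewrite (bowen_dist_finite_word f w k).
  exact: limn_einf_esup_cvg.
apply: filterS sandwich => x xS.
have inf_sup e w k : (corr_sum_inf f P x e w k <= corr_sum_sup f P x e w k)%E.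
  exact: limn_einf_sup.
have half0 (e : R) : 0 < e -> 0 < e / 2 by move=> e0; rewrite divr_gt0.
split; apply: lim_at_right0_sandwich => [a b ab|e e0].
- apply: le_limn_esup => k; apply: le_mean_log => w.
  + by have /andP[] := phi01 w k a.
  + exact: phi_nd.
  + by have /andP[] := phi01 w k b.
- apply/andP; split; apply: le_limn_esup => k; apply: le_mean_log => w;
    have [up down] := xS w k e _ (half0 _ e0).
  + by apply: le_trans down; have /andP[] := phi01 w k (e - e / 2).
  + exact: le_trans (inf_sup _ _ _) up.
  + by have /andP[] := phi01 w k (e + e / 2).
  + by have /andP[] := phi01 w k (e - e / 2).
  + exact: down.
  + apply: le_trans (inf_sup _ _ _) (le_trans up _).
    by have /andP[] := phi01 w k (e + e / 2).
- apply: le_limn_einf => k; apply: le_mean_log => w.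
  + by have /andP[] := phi01 w k a.
  + exact: phi_nd.
  + by have /andP[] := phi01 w k b.
apply/andP; split; apply: le_limn_einf => k; apply: le_mean_log => w;
  have [up down] := xS w k e _ (half0 _ e0).
+ apply: le_trans (le_trans down (inf_sup _ _ _)).
  by have /andP[] := phi01 w k (e - e / 2).
+ exact: up.
+ by have /andP[] := phi01 w k (e + e / 2).
+ by have /andP[] := phi01 w k (e - e / 2).
+ exact: le_trans down (inf_sup _ _ _).
+ by apply: (le_trans up); have /andP[] := phi01 w k (e + e / 2).
Qed.
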